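(* Let $T\ge 3$ be an integer. For each integer $N\ge 1$ define $$\psi_j=\psi_j(N,T)=\frac{\pi\bigl(2+T(2j-1)\bigr)}{2+(N-1)T},$$ and $$P_N=\frac{T}{2+(N-1)T}\prod_{j=1}^{\frac{N-2}{2}}\cot^2\frac{\psi_j}{2}\quad\text{if $N$ is even},\qquad P_N=\prod_{j=1}^{\frac{N-1}{2}}\cot^2\frac{\psi_j}{2}\quad\text{if $N$ is odd}$$ (an empty product equals $1$). Then $$\lim_{N\to\infty} P_N\, N^{2/T}=\pi^{\frac{2-T}{T}}\left(\Gamma\!\left(\frac{T+2}{2T}\right)\right)^2 .$$ In particular $P_N\asymp N^{-2/T}$ as $N\to\infty$.
   Context: $\Gamma$ denotes the Euler Gamma function. The limit is taken over all integers $N\to\infty$ (both parities), with $T$ fixed. *)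

(* Defs.v *)
From Stdlib Require Import Reals.
Open Scope R_scope.

Fixpoint prod_1_to (f : nat -> R) (m : nat) : R :=
  match m with
  | O => 1
  | S k => prod_1_to f k * f (S k)
  end.

Definition cot (x : R) : R := cos x / sin x.

Definition psi (N T j : nat) : R :=
  PI * (2 + INR T * (2 * INR j - 1)) / (2 + (INR N - 1) * INR T).

Definition P (T N : nat) : R :=
  if Nat.even N then
    INR T / (2 + (INR N - 1) * INR T) *
      prod_1_to (fun j => (cot (psi N T j / 2)) ^ 2) ((N - 2) / 2)
  else
    prod_1_to (fun j => (cot (psi N T j / 2)) ^ 2) ((N - 1) / 2).

(* Euler Gamma function via its defining (improper Riemann) integral:
   is_Gamma x g  <->  g = \int_0^\infty t^(x-1) e^(-t) dt
   (limit of RiemannInt over [a,b] as a -> 0+, b -> +oo). *)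
Definition Gamma_integrand (x : R) (t : R) : R := Rpower t (x - 1) * exp (- t).

Definition is_Gamma (x g : R) : Prop :=
  forall eps : R, eps > 0 ->
  exists d : R, d > 0 /\
    forall (a b : R) (pr : Riemann_integrable (Gamma_integrand x) a b),
      0 < a < d -> b > 1 / d -> Rabs (RiemannInt pr - g) < eps.

(* Main.v *)
(* Put a = (T+2)/(2T), and N = 2n + 2c with c = 1 (N even) or c = 1/2 (N odd). With w = pi / (2(n+a+c-1)) one has
   psi_j / 2 = w (j-1+a), and pi/2 - psi_j/2 = w (n-j+c); so after reversing the order of the cosines the product
   is the square of  prod_j sin(w (j-1+c)) / sin(w (j-1+a)).  Write sin x = x * sinc x.  The linear factors give
   a ratio of Pochhammer symbols, whose asymptotics is Gauss's limit for Gamma(a) (from the log-convexity of the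
   integral, as in Bohr-Mollerup) together with Wallis's formula when c = 1/2.  The sinc factors tend to
   (2/pi)^(c-a), because ln sinc is concave on (0, pi) and goes from 0 at 0 to ln (2/pi) at pi/2. *)
Require Import Defs.
From Stdlib Require Import Reals Lra Lia.
From Coquelicot Require Import Coquelicot.
Open Scope R_scope.

(** * Convergence of the Gamma integral for exponents in (0, 1] *)

Definition gamma_filter : (R * R -> Prop) -> Prop :=
  filter_prod (at_right 0) (Rbar_locally p_infty).

(** Filter form of [is_Gamma]: limits along [gamma_filter] can be added, scaled and compared, and
    [is_gamma_lim_is_Gamma] translates back. *)
Definition is_gamma_lim (x g : R) : Prop :=
  filterlim (fun p => RInt (Gamma_integrand x) (fst p) (snd p))
    gamma_filter (locally g).

Lemma gamma_filter_proper : ProperFilter gamma_filter.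
Proof. apply filter_prod_proper. Qed.

Lemma gamma_filter_ge (s b : R) : 0 < s ->
  gamma_filter (fun p => 0 < fst p < s /\ b < snd p).
Proof.
intros Hs.
apply (Filter_prod _ _ _ (fun u => 0 < u < s) (fun v => b < v)).
- exists (mkposreal s Hs). intros y Hy Hy0.
  unfold ball in Hy; simpl in Hy; unfold AbsRing_ball, abs, minus, plus, opp in Hy; simpl in Hy.
  apply Rabs_def2 in Hy. lra.
- exists b. auto.
- simpl. auto.
Qed.

Lemma is_derive_Rpower (x t : R) : 0 < t ->
  is_derive (fun t => Rpower t x) t (x * Rpower t (x - 1)).
Proof.
intros Ht. apply is_derive_Reals.
apply derivable_pt_lim_power, Ht.
Qed.

Lemma Gamma_integrand_continuous (x t : R) : 0 < t -> continuous (Gamma_integrand x) t.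
Proof.
intros Ht. unfold Gamma_integrand.
apply (continuous_mult (fun t => Rpower t (x - 1)) (fun t => exp (- t))).
- apply (ex_derive_continuous (V := R_NormedModule)). eexists. apply is_derive_Rpower, Ht.
- apply (ex_derive_continuous (V := R_NormedModule)). auto_derive. trivial.
Qed.

Lemma Gamma_integrand_ex_RInt (x s b : R) : 0 < s -> 0 < b -> ex_RInt (Gamma_integrand x) s b.
Proof.
intros Hs Hb. apply (ex_RInt_continuous (V := R_CompleteNormedModule)). intros z [Hz _].
apply Gamma_integrand_continuous.
eapply Rlt_le_trans; [|apply Hz]. now apply Rmin_case.
Qed.

Lemma Gamma_integrand_pos (x t : R) : 0 < Gamma_integrand x t.
Proof. apply Rmult_lt_0_compat; apply exp_pos. Qed.

Lemma is_gamma_lim_is_Gamma (x g : R) : is_gamma_lim x g -> is_Gamma x g.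
Proof.
intros H eps Heps.
destruct (H (fun y => Rabs (y - g) < eps)) as [Q1 Q2 HQ1 HQ2 HQ].
{ exists (mkposreal eps Heps). intros y Hy. exact Hy. }
destruct HQ1 as [d Hd]. destruct HQ2 as [m Hm].
(* A single threshold has to control both ends: [b > 1 / Rmin d (/ e)] forces [b > e >= m]. The
   maximum with 1 keeps [/ e] positive. *)
pose (e := Rmax m 1).
assert (He1 : m <= e) by apply Rmax_l.
assert (He2 : 1 <= e) by apply Rmax_r.
assert (Hei : 0 < / e) by (apply Rinv_0_lt_compat; lra).
exists (Rmin d (/ e)). split.
{ apply Rmin_case; [apply cond_pos | exact Hei]. }
intros u b pr [Hu1 Hu2] Hb.
assert (Hud : u < d) by (eapply Rlt_le_trans; [exact Hu2 | apply Rmin_l]).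
assert (Hbe : e <= 1 / Rmin d (/ e)).
{ unfold Rdiv. rewrite Rmult_1_l. rewrite <- (Rinv_inv e) at 1.
  apply Rinv_le_contravar.
  - apply Rmin_case; [apply cond_pos | exact Hei].
  - apply Rmin_r. }
rewrite <- RInt_Reals.
apply (HQ u b).
- apply Hd; [|exact Hu1].
  unfold ball; simpl; unfold AbsRing_ball, abs, minus, plus, opp; simpl.
  rewrite Ropp_0, Rplus_0_r, Rabs_pos_eq; lra.
- apply Hm. lra.
Qed.

Lemma exp_le_1 (y : R) : y <= 0 -> exp y <= 1.
Proof.
intros [Hy | ->]; [left; rewrite <- exp_0; now apply exp_increasing | rewrite exp_0; lra].
Qed.

(** Split at 1. On the left the exponential is at most 1 and t^x / x is an antiderivative of what
    remains; on the right [x <= 1] makes the power at most 1, which leaves the integral of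
    exp(-t). *)
Lemma gamma_partial_bound (x s b : R) : 0 < x <= 1 -> 0 < s < 1 -> 1 < b ->
  RInt (Gamma_integrand x) s b <= / x + 1.
Proof.
intros Hx Hs Hb.
rewrite <- (RInt_Chasles (Gamma_integrand x) s 1 b);
  try (apply Gamma_integrand_ex_RInt; lra).
apply Rplus_le_compat.
- assert (H : is_RInt (fun t => Rpower t (x - 1)) s 1
               (minus (Rpower 1 x / x) (Rpower s x / x))).
  { apply (is_RInt_derive (fun t => Rpower t x / x)).
    - intros t [Ht _]. rewrite Rmin_left in Ht by lra.
      replace (Rpower t (x - 1)) with (scal (/ x) (x * Rpower t (x - 1))).
      2:{ unfold scal; simpl; unfold mult; simpl. field; lra. }
      apply (is_derive_ext (fun t => scal (/ x) (Rpower t x))).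
      { intros u. unfold scal; simpl; unfold mult; simpl. field; lra. }
      apply is_derive_scal. apply is_derive_Rpower; lra.
    - intros t [Ht _]. rewrite Rmin_left in Ht by lra.
      apply (ex_derive_continuous (V := R_NormedModule)). eexists. apply is_derive_Rpower; lra. }
  eapply Rle_trans.
  + apply (RInt_le (Gamma_integrand x) (fun t => Rpower t (x - 1)) s 1).
    * lra.
    * apply Gamma_integrand_ex_RInt; lra.
    * eexists; exact H.
    * intros t Ht. unfold Gamma_integrand.
      rewrite <- (Rmult_1_r (Rpower t (x - 1))) at 2.
      apply Rmult_le_compat_l; [left; apply exp_pos|].
      apply exp_le_1. lra.
  + rewrite (is_RInt_unique _ _ _ _ H).
    unfold minus, plus, opp; simpl.
    unfold Rpower at 1. rewrite ln_1, Rmult_0_r, exp_0.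
    assert (0 < Rpower s x / x).
    { apply Rdiv_lt_0_compat; [apply exp_pos | lra]. }
    lra.
- assert (H : is_RInt (fun t => exp (- t)) 1 b (minus (- exp (- b)) (- exp (- 1)))).
  { apply (is_RInt_derive (fun t => - exp (- t))).
    - intros t _. auto_derive; [trivial | ring].
    - intros t _. apply (ex_derive_continuous (V := R_NormedModule)). auto_derive. trivial. }
  eapply Rle_trans.
  + apply (RInt_le (Gamma_integrand x) (fun t => exp (- t)) 1 b).
    * lra.
    * apply Gamma_integrand_ex_RInt; lra.
    * eexists; exact H.
    * intros t Ht. unfold Gamma_integrand.
      rewrite <- (Rmult_1_l (exp (- t))) at 2.
      apply Rmult_le_compat_r; [left; apply exp_pos|].
      assert (0 < ln t) by (rewrite <- ln_1; apply ln_increasing; lra).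
      apply exp_le_1. nra.
  + rewrite (is_RInt_unique _ _ _ _ H).
    unfold minus, plus, opp; simpl.
    assert (exp (- 1) <= 1) by (apply exp_le_1; lra).
    assert (0 < exp (- b)) by apply exp_pos.
    lra.
Qed.

Lemma gamma_partial_mono (x s s' b b' : R) : 0 < s' <= s -> s <= b <= b' ->
  RInt (Gamma_integrand x) s b <= RInt (Gamma_integrand x) s' b'.
Proof.
intros Hs Hb.
rewrite <- (RInt_Chasles (Gamma_integrand x) s' s b');
  try (apply Gamma_integrand_ex_RInt; lra).
rewrite <- (RInt_Chasles (Gamma_integrand x) s b b');
  try (apply Gamma_integrand_ex_RInt; lra).
assert (0 <= RInt (Gamma_integrand x) s' s).
{ apply RInt_ge_0; [lra | apply Gamma_integrand_ex_RInt; lra |].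
  intros; left; apply Gamma_integrand_pos. }
assert (0 <= RInt (Gamma_integrand x) b b').
{ apply RInt_ge_0; [lra | apply Gamma_integrand_ex_RInt; lra |].
  intros; left; apply Gamma_integrand_pos. }
unfold plus; simpl. lra.
Qed.

(** The integrand is positive, so the partial integrals grow with the interval; being bounded, they
    converge to their supremum. *)
Lemma ex_gamma_lim (x : R) : 0 < x <= 1 -> exists g, is_gamma_lim x g.
Proof.
intros Hx.
pose (E := fun y => exists s b, 0 < s < 1 /\ 1 < b /\ y = RInt (Gamma_integrand x) s b).
destruct (completeness E) as [g [Hub Hlub]].
{ exists (/ x + 1). intros y (s & b & Hs & Hb & ->). now apply gamma_partial_bound. }
{ exists (RInt (Gamma_integrand x) (/ 2) 2), (/ 2), 2. repeat split; lra. }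
exists g. intros Q [eps HQ].
assert (Hex : exists s b, 0 < s < 1 /\ 1 < b /\ g - eps < RInt (Gamma_integrand x) s b).
{ apply Classical_Prop.NNPP. intros Hn.
  assert (g <= g - eps).
  { apply Hlub. intros y (s & b & Hs & Hb & ->).
    apply Rnot_lt_le. intros Hlt. apply Hn. now exists s, b. }
  generalize (cond_pos eps). lra. }
destruct Hex as (s & b & Hs & Hb & Hlt).
unfold filtermap.
apply (filter_imp (fun p => 0 < fst p < s /\ b < snd p)).
2:{ apply gamma_filter_ge; lra. }
intros [s' b'] [Hs' Hb']; simpl in *.
apply HQ.
unfold ball; simpl; unfold AbsRing_ball, abs, minus, plus, opp; simpl.
assert (RInt (Gamma_integrand x) s' b' <= g).
{ apply Hub. exists s', b'. repeat split; lra. }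
assert (RInt (Gamma_integrand x) s b <= RInt (Gamma_integrand x) s' b').
{ apply gamma_partial_mono; lra. }
apply Rabs_def1; generalize (cond_pos eps); lra.
Qed.

(** * Limit arithmetic along filters and the functional equation of Gamma *)

Lemma filterlim_Rplus {A : Type} {F : (A -> Prop) -> Prop} {FF : Filter F}
  (u v : A -> R) (l m : R) :
  filterlim u F (locally l) -> filterlim v F (locally m) ->
  filterlim (fun p => u p + v p) F (locally (l + m)).
Proof.
intros Hu Hv. apply (filterlim_comp_2 u v Rplus Hu Hv (filterlim_plus l m)).
Qed.

Lemma filterlim_Rscal {A : Type} {F : (A -> Prop) -> Prop} {FF : Filter F}
  (k : R) (u : A -> R) (l : R) :
  filterlim u F (locally l) -> filterlim (fun p => k * u p) F (locally (k * l)).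
Proof.
intros Hu. exact (filterlim_comp _ _ _ u (fun y => k * y) _ _ _ Hu (filterlim_scal_r k l)).
Qed.

Lemma filterlim_squeeze_0 {A : Type} {F : (A -> Prop) -> Prop} {FF : Filter F} (u : A -> R) :
  (forall eps : posreal, F (fun p => 0 <= u p < eps)) -> filterlim u F (locally 0).
Proof.
intros H Q [eps HQ]. unfold filtermap.
apply (filter_imp (fun p => 0 <= u p < eps)); [|apply H].
intros p Hp. apply HQ. unfold ball; simpl; unfold AbsRing_ball, abs, minus, plus, opp; simpl.
apply Rabs_def1; lra.
Qed.

Lemma Rpower_exp_lim_0 (x : R) : 0 < x ->
  filterlim (fun p : R * R => Rpower (fst p) x * exp (- fst p)) gamma_filter (locally 0).
Proof.
intros Hx. pose proof gamma_filter_proper. apply filterlim_squeeze_0. intros eps.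
apply (filter_imp (fun p => 0 < fst p < Rpower eps (/ x) /\ 0 < snd p)).
2:{ apply gamma_filter_ge, exp_pos. }
intros [s b] [[Hs1 Hs2] _]; simpl in *.
assert (H1 : 0 < Rpower s x) by apply exp_pos.
assert (H2 : 0 < exp (- s)) by apply exp_pos.
assert (H3 : exp (- s) <= 1) by (apply exp_le_1; lra).
assert (H4 : Rpower s x < eps).
{ replace (pos eps) with (Rpower (Rpower eps (/ x)) x).
  - now apply Rlt_Rpower_l.
  - rewrite Rpower_mult. replace (/ x * x) with 1 by (field; lra).
    apply Rpower_1, cond_pos. }
nra.
Qed.

Lemma ln_le_sub_1 (y : R) : 0 < y -> ln y <= y - 1.
Proof.
intros Hy. pose proof (exp_ineq1_le (ln y)) as H. rewrite exp_ln in H; lra.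
Qed.

Lemma Rpower_exp_lim_infty (x : R) : 0 < x ->
  filterlim (fun p : R * R => Rpower (snd p) x * exp (- snd p)) gamma_filter (locally 0).
Proof.
intros Hx. pose proof gamma_filter_proper. apply filterlim_squeeze_0. intros eps.
(* The threshold comes from ln y <= y - 1 at y = b / (2x): it gives x ln b - b <= x ln (2x) - x -
   b/2, which is below ln eps once b exceeds 2 (x ln (2x) - ln eps). *)
apply (filter_imp (fun p => 0 < fst p < 1 /\
                    Rmax 0 (2 * (x * ln (2 * x) - ln eps)) < snd p)).
2:{ apply gamma_filter_ge; lra. }
intros [s b] [_ Hb]; simpl in *.
assert (Hb0 : 0 < b) by (eapply Rle_lt_trans; [apply Rmax_l | exact Hb]).
assert (Hb1 : 2 * (x * ln (2 * x) - ln eps) < b)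
  by (eapply Rle_lt_trans; [apply Rmax_r | exact Hb]).
split.
{ left. apply Rmult_lt_0_compat; apply exp_pos. }
unfold Rpower. rewrite <- exp_plus.
rewrite <- (exp_ln eps) by apply cond_pos.
apply exp_increasing.
assert (Hl : ln b <= b / (2 * x) - 1 + ln (2 * x)).
{ assert (0 < b / (2 * x)) by (apply Rdiv_lt_0_compat; lra).
  replace (ln b) with (ln (b / (2 * x)) + ln (2 * x)).
  - pose proof (ln_le_sub_1 (b / (2 * x))). lra.
  - rewrite <- ln_mult by lra. f_equal. field. lra. }
assert (Hl' : x * ln b <= x * (b / (2 * x) - 1 + ln (2 * x))) by (apply Rmult_le_compat_l; lra).
replace (x * (b / (2 * x) - 1 + ln (2 * x))) with (b / 2 - x + x * ln (2 * x)) in Hl' by (field; lra).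
lra.
Qed.

(** Integration by parts, obtained by integrating the derivative of t^x exp(-t). Both boundary terms
    tend to 0 along [gamma_filter] when x > 0. *)
Lemma RInt_Gamma_succ (x s b : R) : 0 < s -> 0 < b ->
  RInt (Gamma_integrand (x + 1)) s b =
  (Rpower s x * exp (- s) + - 1 * (Rpower b x * exp (- b))) + x * RInt (Gamma_integrand x) s b.
Proof.
intros Hs Hb.
assert (Hm : 0 < Rmin s b) by (now apply Rmin_case).
assert (H : is_RInt (fun t => minus (scal x (Gamma_integrand x t)) (Gamma_integrand (x + 1) t)) s b
   (minus (Rpower b x * exp (- b)) (Rpower s x * exp (- s)))).
{ apply (is_RInt_derive (fun t => Rpower t x * exp (- t))).
  - intros t [Ht _].
    assert (H1 := is_derive_mult (fun t => Rpower t x) (fun t => exp (- t)) t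
            (x * Rpower t (x - 1)) (- exp (- t)) (is_derive_Rpower x t ltac:(lra))).
    replace (minus _ _) with (plus (mult (x * Rpower t (x - 1)) (exp (- t)))
                                   (mult (Rpower t x) (- exp (- t)))).
    + apply H1; [auto_derive; [trivial | ring] |].
      intros; apply Rmult_comm.
    + unfold Gamma_integrand, minus, plus, opp, scal; simpl; unfold mult; simpl.
      replace (x + 1 - 1) with x by ring. ring.
  - intros t [Ht _]. apply (continuous_minus (V := R_NormedModule)).
    + apply (continuous_scal_r (V := R_NormedModule)).
      apply Gamma_integrand_continuous. lra.
    + apply Gamma_integrand_continuous. lra. }
apply (is_RInt_unique (V := R_CompleteNormedModule)) in H.
rewrite (RInt_minus (V := R_CompleteNormedModule)) in H.
2:{ apply (ex_RInt_scal (V := R_NormedModule)). now apply Gamma_integrand_ex_RInt. }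
2:{ now apply Gamma_integrand_ex_RInt. }
rewrite (RInt_scal (V := R_CompleteNormedModule)) in H by (now apply Gamma_integrand_ex_RInt).
unfold minus, plus, opp, scal in H; simpl in H; unfold mult in H; simpl in H. lra.
Qed.

Lemma is_gamma_lim_succ (x g : R) : 0 < x -> is_gamma_lim x g -> is_gamma_lim (x + 1) (x * g).
Proof.
intros Hx Hg. pose proof gamma_filter_proper as PF. unfold is_gamma_lim.
apply (filterlim_ext_loc (fun p =>
  (Rpower (fst p) x * exp (- fst p) + - 1 * (Rpower (snd p) x * exp (- snd p)))
  + x * RInt (Gamma_integrand x) (fst p) (snd p))).
{ apply (filter_imp (fun p => 0 < fst p < 1 /\ 0 < snd p)).
  2:{ apply gamma_filter_ge; lra. }
  intros p Hp. symmetry. apply RInt_Gamma_succ; lra. }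
replace (x * g) with (0 + - 1 * 0 + x * g) by ring.
apply filterlim_Rplus; [apply filterlim_Rplus |].
- now apply Rpower_exp_lim_0.
- apply filterlim_Rscal. now apply Rpower_exp_lim_infty.
- now apply filterlim_Rscal.
Qed.

Lemma is_gamma_lim_1 : is_gamma_lim 1 1.
Proof.
pose proof gamma_filter_proper as PF. unfold is_gamma_lim.
(* The integral exp(-s) - exp(-b) is written as 1 minus two nonnegative quantities, each of which is
   squeezed to 0. *)
apply (filterlim_ext_loc (fun p => (1 + - 1 * (1 - exp (- fst p))) + - 1 * (exp (- snd p)))).
{ apply (filter_imp (fun p => 0 < fst p < 1 /\ 0 < snd p)).
  2:{ apply gamma_filter_ge; lra. }
  intros [s b] Hp; simpl in *. symmetry.
  rewrite (RInt_ext _ (fun t => exp (- t))).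
  2:{ intros t Ht. unfold Gamma_integrand, Rpower.
      replace ((1 - 1) * ln t) with 0 by ring. rewrite exp_0; apply Rmult_1_l. }
  assert (H : is_RInt (fun t => exp (- t)) s b (minus (- exp (- b)) (- exp (- s)))).
  { apply (is_RInt_derive (fun t => - exp (- t))).
    - intros t _. auto_derive; [trivial | ring].
    - intros t _. apply (ex_derive_continuous (V := R_NormedModule)). auto_derive. trivial. }
  rewrite (is_RInt_unique _ _ _ _ H). unfold minus, plus, opp; simpl. ring. }
replace (locally 1) with (locally (1 + - 1 * 0 + - 1 * 0)) by (f_equal; ring).
apply filterlim_Rplus; [apply filterlim_Rplus |].
- apply filterlim_const.
- apply filterlim_Rscal, filterlim_squeeze_0. intros eps.
  apply (filter_imp (fun p => 0 < fst p < eps /\ 0 < snd p)).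
  2:{ apply gamma_filter_ge, cond_pos. }
  intros p [Hp _]. pose proof (exp_ineq1_le (- fst p)).
  assert (exp (- fst p) <= 1) by (apply exp_le_1; lra). lra.
- apply filterlim_Rscal, filterlim_squeeze_0. intros eps.
  apply (filter_imp (fun p => 0 < fst p < 1 /\ - ln eps < snd p)).
  2:{ apply gamma_filter_ge; lra. }
  intros p [_ Hp]. split; [left; apply exp_pos |].
  rewrite <- (exp_ln eps) by apply cond_pos. apply exp_increasing. lra.
Qed.

(** * Log-convexity of Gamma and the bounds behind Gauss's limit *)

Lemma weighted_am_gm (th y : R) : 0 < th < 1 -> exp (th * y) <= 1 - th + th * exp y.
Proof.
intros Hth.
pose proof (exp_ineq1_le ((1 - th) * y)) as H1.
pose proof (exp_ineq1_le (- (th * y))) as H2.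
assert (E1 : exp y = exp (th * y) * exp ((1 - th) * y)) by (rewrite <- exp_plus; f_equal; ring).
assert (E2 : exp (th * y) * exp (- (th * y)) = 1)
  by (rewrite <- exp_plus; replace (th * y + - (th * y)) with 0 by ring; apply exp_0).
assert (H0 := exp_pos (th * y)).
(* With weights [th] and [1 - th] the linear terms of the tangent bounds [H1] and [H2] cancel;
   multiplying by [exp (th * y)] then gives the claim. *)
assert (H3 : 1 <= th * exp ((1 - th) * y) + (1 - th) * exp (- (th * y))) by nra.
apply (Rmult_le_compat_l (exp (th * y))) in H3; [|lra].
rewrite E1. nra.
Qed.

(* Log-convexity of Gamma, in the form obtained from the tangent line at x of the concave map t |-> t^th. *)
Lemma gamma_lim_shift_le (x th g0 g : R) : 0 < x -> 0 < th < 1 ->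
  is_gamma_lim x g0 -> is_gamma_lim (x + th) g -> g <= Rpower x th * g0.
Proof.
intros Hx Hth H0 H. pose proof gamma_filter_proper as PF.
assert (H1 := is_gamma_lim_succ x g0 Hx H0).
(* Intercept and slope of the tangent. Integrating t^th <= A + B t against the Gamma integrand at
   [x] yields A [g0] + B (x [g0]), which is x^th [g0]. *)
pose (A := (1 - th) * Rpower x th). pose (B := th * Rpower x th / x).
assert (HL : filterlim (fun p => A * RInt (Gamma_integrand x) (fst p) (snd p)
                              + B * RInt (Gamma_integrand (x + 1)) (fst p) (snd p))
           gamma_filter (locally (A * g0 + B * (x * g0)))).
{ apply filterlim_Rplus; now apply filterlim_Rscal. }
replace (Rpower x th * g0) with (A * g0 + B * (x * g0)) by (unfold A, B; field; lra).
refine (filterlim_le (F := gamma_filter)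
         (fun p => RInt (Gamma_integrand (x + th)) (fst p) (snd p)) _ (Finite g) (Finite _)
         _ H HL).
apply (filter_imp (fun p => 0 < fst p < 1 /\ 1 < snd p)); [| apply gamma_filter_ge; lra].
intros [s b]; simpl; intros [Hs Hb].
assert (Hex : forall y, ex_RInt (Gamma_integrand y) s b)
  by (intros; apply Gamma_integrand_ex_RInt; lra).
rewrite <- (RInt_scal (V := R_CompleteNormedModule) _ _ _ A) by apply Hex.
rewrite <- (RInt_scal (V := R_CompleteNormedModule) _ _ _ B) by apply Hex.
rewrite <- (RInt_plus (V := R_CompleteNormedModule))
  by (apply (ex_RInt_scal (V := R_NormedModule)); apply Hex).
apply RInt_le; [lra | apply Hex | |].
{ apply (ex_RInt_plus (V := R_NormedModule));
    apply (ex_RInt_scal (V := R_NormedModule)); apply Hex. }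
intros t Ht. unfold plus, scal; simpl; unfold mult; simpl.
unfold Gamma_integrand, A, B.
assert (Ht0 : 0 < t) by lra.
assert (HAG := weighted_am_gm th (ln t - ln x) Hth).
assert (E1 : Rpower t (x + th - 1) = Rpower t (x - 1) * Rpower x th * exp (th * (ln t - ln x))).
{ unfold Rpower. rewrite <- !exp_plus. f_equal. ring. }
assert (E2 : Rpower t (x + 1 - 1) = Rpower t (x - 1) * t).
{ rewrite <- (Rpower_1 t Ht0) at 3. rewrite <- Rpower_plus. f_equal. ring. }
assert (E3 : exp (ln t - ln x) = t / x).
{ unfold Rminus. rewrite exp_plus, exp_Ropp, !exp_ln by lra. reflexivity. }
rewrite E1, E2. rewrite E3 in HAG.
assert (P1 : 0 < Rpower t (x - 1) * Rpower x th * exp (- t)).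
{ repeat apply Rmult_lt_0_compat; apply exp_pos. }
apply (Rmult_le_compat_l _ _ _ (Rlt_le _ _ P1)) in HAG.
replace ((1 - th) * Rpower x th * (Rpower t (x - 1) * exp (- t)) +
   th * Rpower x th / x * (Rpower t (x - 1) * t * exp (- t)))
  with (Rpower t (x - 1) * Rpower x th * exp (- t) * (1 - th + th * (t / x))) by (field; lra).
lra.
Qed.

(** The rising factorial x (x+1) ... (x+n-1), equal to Gamma(x+n) / Gamma(x); in particular
    [poch 1 n] is n!. *)
Definition poch (x : R) (n : nat) : R := prod_1_to (fun j => INR j - 1 + x) n.

Lemma poch_S (x : R) (n : nat) : poch x (S n) = poch x n * (INR n + x).
Proof. unfold poch. cbn [prod_1_to]. rewrite S_INR. f_equal. ring. Qed.

Lemma poch_pos (x : R) (n : nat) : 0 < x -> 0 < poch x n.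
Proof.
intros Hx. induction n as [|n IH]; [unfold poch; simpl; lra|].
rewrite poch_S. pose proof (pos_INR n). apply Rmult_lt_0_compat; lra.
Qed.

Lemma is_gamma_lim_poch (x g : R) (n : nat) : 0 < x ->
  is_gamma_lim x g -> is_gamma_lim (INR n + x) (poch x n * g).
Proof.
intros Hx Hg. induction n as [|n IH].
- unfold poch; simpl. now rewrite Rplus_0_l, Rmult_1_l.
- rewrite poch_S, S_INR. replace (INR n + 1 + x) with (INR n + x + 1) by ring.
  replace (poch x n * (INR n + x) * g) with ((INR n + x) * (poch x n * g)) by ring.
  apply is_gamma_lim_succ; [|exact IH]. pose proof (pos_INR n). lra.
Qed.

(** Log-convexity is used twice: the step from n to n + a gives Gamma(n+a) <= n^a Gamma(n), the
    lower bound; the step from n + a to n + 1 gives Gamma(n+1) <= (n+a)^(1-a) Gamma(n+a), the upper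
    bound. *)
Lemma gauss_bounds (a g : R) (n : nat) : 0 < a < 1 -> (1 <= n)%nat -> is_gamma_lim a g ->
  g <= poch 1 n / poch a n * Rpower (INR n) (a - 1)
    <= g * Rpower ((INR n + a) / INR n) (1 - a).
Proof.
intros Ha Hn Hg.
assert (HnR : 1 <= INR n) by (now apply (le_INR 1)).
assert (Hp := poch_pos a n (proj1 Ha)).
assert (Hp1 := poch_pos 1 n Rlt_0_1).
assert (Gn := is_gamma_lim_poch a g n (proj1 Ha) Hg).
split.
- destruct n as [|m]; [lia|].
  assert (Gm := is_gamma_lim_poch 1 1 m Rlt_0_1 is_gamma_lim_1).
  rewrite <- S_INR in Gm.
  assert (H := gamma_lim_shift_le (INR (S m)) a _ _ ltac:(lra) Ha Gm Gn).
  assert (E : poch 1 (S m) * Rpower (INR (S m)) (a - 1) = Rpower (INR (S m)) a * (poch 1 m * 1)).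
  { rewrite poch_S, <- S_INR.
    replace (Rpower (INR (S m)) a) with (Rpower (INR (S m)) (1 + (a - 1))) by (f_equal; ring).
    rewrite Rpower_plus, Rpower_1 by lra. ring. }
  apply (Rmult_le_reg_l (poch a (S m))); [exact Hp|].
  replace (poch a (S m) * (poch 1 (S m) / poch a (S m) * Rpower (INR (S m)) (a - 1)))
    with (poch 1 (S m) * Rpower (INR (S m)) (a - 1)) by (field; lra).
  lra.
- assert (G1 := is_gamma_lim_poch 1 1 n Rlt_0_1 is_gamma_lim_1).
  replace (INR n + 1) with (INR n + a + (1 - a)) in G1 by ring.
  assert (H := gamma_lim_shift_le (INR n + a) (1 - a) _ _ ltac:(lra) ltac:(lra) Gn G1).
  assert (E : Rpower ((INR n + a) / INR n) (1 - a)
              = Rpower (INR n + a) (1 - a) * Rpower (INR n) (a - 1)).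
  { unfold Rpower. rewrite ln_div by lra. rewrite <- exp_plus. f_equal. ring. }
  rewrite E.
  apply (Rmult_le_reg_l (poch a n)); [exact Hp|].
  replace (poch a n * (poch 1 n / poch a n * Rpower (INR n) (a - 1)))
    with (poch 1 n * 1 * Rpower (INR n) (a - 1)) by (field; lra).
  replace (poch a n * (g * (Rpower (INR n + a) (1 - a) * Rpower (INR n) (a - 1)))) with
    (Rpower (INR n + a) (1 - a) * (poch a n * g) * Rpower (INR n) (a - 1)) by ring.
  apply Rmult_le_compat_r; [left; apply exp_pos | exact H].
Qed.

(** * Sequence limits and Gauss's limit for Gamma(a) *)

Lemma is_lim_seq_Rpower (u : nat -> R) (l e : R) : 0 < l ->
  is_lim_seq u l -> is_lim_seq (fun n => Rpower (u n) e) (Rpower l e).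
Proof.
intros Hl Hu. apply (is_lim_seq_continuous (fun t => Rpower t e)); [|exact Hu].
apply derivable_continuous_pt. eexists. now apply derivable_pt_lim_power.
Qed.

Lemma is_lim_seq_inv_shift (d : R) : is_lim_seq (fun n => / (INR n + d)) 0.
Proof.
apply (is_lim_seq_inv _ p_infty); [|discriminate].
apply (is_lim_seq_plus _ _ p_infty d); [apply is_lim_seq_INR | apply is_lim_seq_const | reflexivity].
Qed.

Lemma eventually_INR_gt (d : R) : eventually (fun n => d < INR n).
Proof.
destruct (INR_unbounded d) as [n0 H0]. exists n0. intros n Hn.
apply le_INR in Hn. lra.
Qed.

Lemma is_lim_seq_shift_ratio (c d : R) :
  is_lim_seq (fun n => (INR n + c) / (INR n + d)) 1.
Proof.
apply (is_lim_seq_ext_loc (fun n => 1 + (c - d) * / (INR n + d))).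
{ apply (filter_imp (fun n => - d < INR n)); [|apply eventually_INR_gt].
  intros n Hn. field. lra. }
replace (Finite 1) with (Finite (1 + (c - d) * 0)) by (f_equal; ring).
apply is_lim_seq_plus'; [apply is_lim_seq_const|].
apply is_lim_seq_mult'; [apply is_lim_seq_const | apply is_lim_seq_inv_shift].
Qed.

Lemma gauss_limit (a g : R) : 0 < a < 1 -> is_gamma_lim a g ->
  is_lim_seq (fun n => poch 1 n / poch a n * Rpower (INR n) (a - 1)) g.
Proof.
intros Ha Hg.
apply (is_lim_seq_le_le_loc (fun _ => g) _ (fun n => g * Rpower ((INR n + a) / INR n) (1 - a))).
- exists 1%nat. intros n Hn. now apply gauss_bounds.
- apply is_lim_seq_const.
- replace (Finite g) with (Finite (g * Rpower 1 (1 - a))).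
  2:{ unfold Rpower. rewrite ln_1, Rmult_0_r, exp_0. f_equal. ring. }
  apply is_lim_seq_mult'; [apply is_lim_seq_const|].
  apply is_lim_seq_Rpower; [lra|].
  apply (is_lim_seq_ext (fun n => (INR n + a) / (INR n + 0))).
  + intros n. now rewrite Rplus_0_r.
  + apply is_lim_seq_shift_ratio.
Qed.

(** * Wallis's formula for the ratio of rising factorials at 1/2 and 1 *)

Definition wallis (n : nat) : R := RInt (fun t => sin t ^ n) 0 (PI / 2).

Lemma sin_pow_ex_RInt (n : nat) (x y : R) : ex_RInt (fun t => sin t ^ n) x y.
Proof.
apply (ex_RInt_continuous (V := R_CompleteNormedModule)). intros t _.
apply (ex_derive_continuous (V := R_NormedModule)). auto_derive. trivial.
Qed.

Lemma wallis_0 : wallis 0 = PI / 2.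
Proof.
unfold wallis. simpl. rewrite RInt_const. unfold scal; simpl; unfold mult; simpl. lra.
Qed.

Lemma wallis_1 : wallis 1 = 1.
Proof.
unfold wallis. apply (is_RInt_unique (V := R_CompleteNormedModule)).
replace 1 with (minus (- cos (PI / 2)) (- cos 0)).
2:{ rewrite cos_PI2, cos_0. unfold minus, plus, opp; simpl. ring. }
apply (is_RInt_derive (fun t => - cos t)).
- intros t _. auto_derive; [trivial | ring].
- intros t _. apply (ex_derive_continuous (V := R_NormedModule)). auto_derive. trivial.
Qed.

(** The function -cos t sin^(n+1) t vanishes at 0 and at pi/2, and by cos^2 = 1 - sin^2 its
    derivative is (n+2) sin^(n+2) t - (n+1) sin^n t. *)
Lemma wallis_rec (n : nat) : (INR n + 2) * wallis (S (S n)) = (INR n + 1) * wallis n.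
Proof.
assert (H : is_RInt (fun t => minus (scal (INR n + 2) (sin t ^ S (S n))) (scal (INR n + 1) (sin t ^ n)))
              0 (PI / 2)
              (minus (- cos (PI / 2) * sin (PI / 2) ^ S n) (- cos 0 * sin 0 ^ S n))).
{ apply (is_RInt_derive (fun t => - cos t * sin t ^ S n)).
  - intros t _. auto_derive; [trivial|].
    change (Init.Nat.pred (S n)) with n.
    unfold minus, plus, opp, scal; simpl; unfold mult; simpl.
    assert (E : cos t * cos t = 1 - sin t * sin t).
    { pose proof (sin2_cos2 t) as E. unfold Rsqr in E. lra. }
    change (match n with O => 1 | S _ => INR n + 1 end) with (INR (S n)). rewrite S_INR.
    replace (_ + _) with (sin t * (sin t * sin t ^ n) + - ((INR n + 1) * sin t ^ n) * (cos t * cos t)) by ring.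
    rewrite E. ring.
  - intros t _. apply (ex_derive_continuous (V := R_NormedModule)).
    unfold minus, plus, opp, scal; simpl; unfold mult; simpl.
    auto_derive. trivial. }
apply (is_RInt_unique (V := R_CompleteNormedModule)) in H.
rewrite (RInt_minus (V := R_CompleteNormedModule)) in H
  by (apply (ex_RInt_scal (V := R_NormedModule)); apply sin_pow_ex_RInt).
rewrite !(RInt_scal (V := R_CompleteNormedModule)) in H by apply sin_pow_ex_RInt.
rewrite cos_PI2, sin_0 in H.
unfold minus, plus, opp, scal in H; simpl in H; unfold mult in H; simpl in H.
unfold wallis. simpl. lra.
Qed.

Lemma wallis_decr (n : nat) : wallis (S n) <= wallis n.
Proof.
pose proof PI_RGT_0. apply RInt_le; [lra | apply sin_pow_ex_RInt | apply sin_pow_ex_RInt |].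
intros t Ht. simpl.
assert (0 <= sin t) by (apply sin_ge_0; lra).
pose proof (SIN_bound t). pose proof (pow_le (sin t) n H0). nra.
Qed.

Lemma wallis_even (n : nat) : wallis (2 * n) = PI / 2 * (poch (1 / 2) n / poch 1 n).
Proof.
induction n as [|n IH].
- simpl. rewrite wallis_0. unfold poch; simpl. field.
- replace (2 * S n)%nat with (S (S (2 * n))) by lia.
  pose proof (wallis_rec (2 * n)) as H. rewrite IH, mult_INR in H. simpl (INR 2) in H.
  pose proof (pos_INR n). rewrite !poch_S.
  pose proof (poch_pos 1 n Rlt_0_1).
  apply (Rmult_eq_reg_l ((1 + 1) * INR n + 2)); [|lra].
  rewrite H. field. lra.
Qed.

(** The closed form has the rising factorial at 3/2 in its denominator; the factor [2 * INR n + 1]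
    brings it back to 1/2, to match [wallis_even]. *)
Lemma wallis_odd (n : nat) :
  wallis (S (2 * n)) * (2 * INR n + 1) = poch 1 n / poch (1 / 2) n.
Proof.
induction n as [|n IH].
- simpl (2 * 0)%nat. rewrite wallis_1. unfold poch; simpl. field.
- replace (S (2 * S n)) with (S (S (S (2 * n)))) by lia.
  pose proof (wallis_rec (S (2 * n))) as H. rewrite !S_INR, mult_INR in H. simpl (INR 2) in H.
  pose proof (pos_INR n). rewrite !poch_S, S_INR.
  pose proof (poch_pos (1 / 2) n ltac:(lra)).
  replace (wallis (S (S (S (2 * n)))) * (2 * (INR n + 1) + 1))
    with (((1 + 1) * INR n + 1 + 2) * wallis (S (S (S (2 * n))))) by ring.
  rewrite H.
  replace (((1 + 1) * INR n + 1 + 1) * wallis (S (2 * n))) with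
    ((wallis (S (2 * n)) * (2 * INR n + 1)) * ((2 * INR n + 2) / (2 * INR n + 1))) by (field; lra).
  rewrite IH. field. lra.
Qed.

(** With q the ratio of rising factorials, the even integral is q pi/2 and the odd one is 1 / (q
    (2n+1)). That the odd one lies between its two even neighbours bounds q^2 n from both sides. *)
Lemma wallis_bounds (n : nat) :
  / PI * (INR n / (INR n + 1 / 2)) <= (poch (1 / 2) n / poch 1 n) ^ 2 * INR n <= / PI.
Proof.
pose proof PI_RGT_0 as HPI. pose proof (pos_INR n) as Hn.
pose proof (poch_pos 1 n Rlt_0_1) as H1.
pose proof (poch_pos (1 / 2) n ltac:(lra)) as H2.
pose proof (wallis_odd n) as Ho.
pose proof (wallis_decr (2 * n)) as D1. rewrite wallis_even in D1.
pose proof (wallis_decr (S (2 * n))) as D2.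
replace (S (S (2 * n))) with (2 * S n)%nat in D2 by lia.
rewrite wallis_even, !poch_S in D2.
set (q := poch (1 / 2) n / poch 1 n) in *.
assert (Hq : 0 < q) by now apply Rdiv_lt_0_compat.
replace (poch 1 n / poch (1 / 2) n) with (/ q) in Ho by (unfold q; field; lra).
replace (poch (1 / 2) n * (INR n + 1 / 2) / (poch 1 n * (INR n + 1)))
  with (q * ((INR n + 1 / 2) / (INR n + 1))) in D2 by (unfold q; field; lra).
assert (Ew : wallis (S (2 * n)) = / (q * (2 * INR n + 1))).
{ apply (Rmult_eq_reg_r (2 * INR n + 1)); [|lra]. rewrite Ho. field. lra. }
rewrite Ew in D1, D2.
split.
- apply (Rmult_le_compat_l (q * (2 * INR n) / PI)) in D1.
  2:{ apply Rmult_le_pos; [nra | left; now apply Rinv_0_lt_compat]. }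
  replace (q * (2 * INR n) / PI * / (q * (2 * INR n + 1)))
    with (/ PI * (INR n / (INR n + 1 / 2))) in D1 by (field; lra).
  replace (q * (2 * INR n) / PI * (PI / 2 * q)) with (q ^ 2 * INR n) in D1 by (field; lra).
  exact D1.
- apply (Rmult_le_compat_l (q * (INR n + 1) * 2 / (PI * (INR n + 1 / 2)) * INR n)) in D2.
  2:{ apply Rmult_le_pos; [|lra]. left. apply Rdiv_lt_0_compat; nra. }
  replace (q * (INR n + 1) * 2 / (PI * (INR n + 1 / 2)) * INR n *
      (PI / 2 * (q * ((INR n + 1 / 2) / (INR n + 1))))) with (q ^ 2 * INR n) in D2 by (field; lra).
  replace (q * (INR n + 1) * 2 / (PI * (INR n + 1 / 2)) * INR n * / (q * (2 * INR n + 1)))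
    with (/ PI * (INR n * (INR n + 1) / (INR n + 1 / 2) ^ 2)) in D2 by (field; lra).
  (* What remains is n (n+1) <= (n + 1/2)^2. *)
  eapply Rle_trans; [exact D2|].
  rewrite <- (Rmult_1_r (/ PI)) at 2.
  apply Rmult_le_compat_l; [left; now apply Rinv_0_lt_compat|].
  apply -> Rdiv_le_1; [nra | apply pow_lt; lra].
Qed.

Lemma wallis_limit :
  is_lim_seq (fun n => (poch (1 / 2) n / poch 1 n) ^ 2 * INR n) (/ PI).
Proof.
apply (is_lim_seq_le_le (fun n => / PI * (INR n / (INR n + 1 / 2))) _ (fun _ => / PI)).
- apply wallis_bounds.
- replace (Finite (/ PI)) with (Finite (/ PI * 1)) by (f_equal; ring).
  apply is_lim_seq_mult'; [apply is_lim_seq_const|].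
  apply (is_lim_seq_ext (fun n => (INR n + 0) / (INR n + 1 / 2))).
  + intros n. now rewrite Rplus_0_r.
  + apply is_lim_seq_shift_ratio.
- apply is_lim_seq_const.
Qed.

(** * Concavity of ln sinc and the limit of the sinc factors *)

Definition sinc (x : R) : R := sin x / x.

Lemma sinc_pos (x : R) : 0 < x < PI -> 0 < sinc x.
Proof. intros Hx. apply Rdiv_lt_0_compat; [apply sin_gt_0|]; lra. Qed.

Lemma ln_sinc_derive (x : R) : 0 < x < PI ->
  derivable_pt_lim (fun x => ln (sinc x)) x (cos x / sin x - / x).
Proof.
intros Hx. assert (Hs : 0 < sin x) by (apply sin_gt_0; lra).
pose proof (sinc_pos x Hx) as Hp. unfold sinc in *.
apply is_derive_Reals. auto_derive.
- repeat split; lra.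
- field. lra.
Qed.

(** The derivative of cot t - 1/t is 1/t^2 - 1/sin^2 t, which is negative because 0 < sin t < t. *)
Lemma ln_sinc_derive_decr (x y : R) : 0 < x -> x < y -> y < PI ->
  cos y / sin y - / y <= cos x / sin x - / x.
Proof.
intros Hx Hxy Hy.
destruct (MVT_cor2 (fun t => cos t / sin t - / t)
            (fun t => / t ^ 2 - / sin t ^ 2) x y Hxy) as (c & Hc & Hc').
{ intros c Hc. assert (0 < sin c) by (apply sin_gt_0; lra).
  apply is_derive_Reals. auto_derive; [lra|].
  pose proof (sin2_cos2 c) as E. unfold Rsqr in E.
  replace (cos c) with (cos c * 1) by ring.
  apply (Rmult_eq_reg_r (sin c ^ 2 * c ^ 2)); [|apply Rgt_not_eq; apply Rmult_lt_0_compat; apply pow_lt; lra].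
  field_simplify; [|lra|lra].
  replace (cos c ^ 2) with (1 - sin c ^ 2) by (simpl; lra). ring. }
assert (Hs : 0 < sin c) by (apply sin_gt_0; lra).
assert (Hsc : sin c < c) by (apply sin_lt_x; lra).
assert (/ c ^ 2 <= / sin c ^ 2).
{ apply Rinv_le_contravar; [now apply pow_lt | apply pow_incr; lra]. }
simpl in *. nra.
Qed.

(** Comparison of chord slopes on two adjacent segments, with denominators cleared: by the mean
    value theorem each slope is a value of the decreasing derivative. *)
Lemma ln_sinc_concave (x y z : R) : 0 < x -> x < y -> y < z -> z < PI ->
  (ln (sinc z) - ln (sinc y)) * (y - x) <= (ln (sinc y) - ln (sinc x)) * (z - y).
Proof.
intros Hx Hxy Hyz Hz.
destruct (MVT_cor2 (fun t => ln (sinc t)) (fun t => cos t / sin t - / t) x y Hxy)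
  as (c & Hc & Hc'); [intros; apply ln_sinc_derive; lra|].
destruct (MVT_cor2 (fun t => ln (sinc t)) (fun t => cos t / sin t - / t) y z Hyz)
  as (d & Hd & Hd'); [intros; apply ln_sinc_derive; lra|].
pose proof (ln_sinc_derive_decr c d ltac:(lra) ltac:(lra) ltac:(lra)) as H.
rewrite Hc, Hd.
apply (Rmult_le_compat_r ((y - x) * (z - y))) in H; [lra | nra].
Qed.

(** The sinc part of the cotangent product, with [v = c] in the numerator and [u = a] in the
    denominator. *)
Definition sinc_ratio (u v w : R) (n : nat) : R :=
  prod_1_to (fun j => sinc (w * (INR j - 1 + v)) / sinc (w * (INR j - 1 + u))) n.

Lemma sinc_ratio_S (u v w : R) (n : nat) :
  sinc_ratio u v w (S n) = sinc_ratio u v w n * (sinc (w * (INR n + v)) / sinc (w * (INR n + u))).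
Proof.
unfold sinc_ratio. cbn [prod_1_to]. rewrite S_INR.
now replace (INR n + 1 - 1) with (INR n) by ring.
Qed.

Lemma scaled_index_bounds (w y z : R) : 0 < w -> 0 < y -> y <= z -> w * z < PI ->
  0 < w * y < PI.
Proof. intros. split; nra. Qed.

Lemma sinc_ratio_pos (u v w : R) (n : nat) : 0 < w -> 0 < u < v -> w * (INR n + v) < PI ->
  0 < sinc_ratio u v w n.
Proof.
intros Hw Hu. induction n as [|n IH]; intros H.
- unfold sinc_ratio; simpl; lra.
- rewrite S_INR in H. pose proof (pos_INR n). rewrite sinc_ratio_S.
  apply Rmult_lt_0_compat; [apply IH; nra|].
  apply Rdiv_lt_0_compat; apply sinc_pos;
    apply (scaled_index_bounds _ _ (INR n + 1 + v)); lra.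
Qed.

Lemma ln_sinc_ratio_S (u v w : R) (n : nat) : 0 < w -> 0 < u < v -> w * (INR n + v) < PI ->
  ln (sinc_ratio u v w (S n)) =
  ln (sinc_ratio u v w n) + (ln (sinc (w * (INR n + v))) - ln (sinc (w * (INR n + u)))).
Proof.
intros Hw Hu H. pose proof (pos_INR n).
pose proof (sinc_ratio_pos u v w n Hw Hu H).
assert (0 < sinc (w * (INR n + v)))
  by (apply sinc_pos, (scaled_index_bounds _ _ (INR n + v)); lra).
assert (0 < sinc (w * (INR n + u)))
  by (apply sinc_pos, (scaled_index_bounds _ _ (INR n + v)); lra).
rewrite sinc_ratio_S, ln_mult, ln_div; trivial. now apply Rdiv_lt_0_compat.
Qed.

(* The slope of the concave function ln sinc on each segment [w(k+u), w(k+v)] is compared with its slope on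
   the adjacent segment of length w, over which the increments telescope; hence the two bounds below. *)
Lemma ln_sinc_ratio_lower (u v w : R) (n : nat) :
  0 < w -> 0 < u < v -> w * (INR n + v) < PI ->
  (v - u) * (ln (sinc (w * (INR n + v))) - ln (sinc (w * v))) <= ln (sinc_ratio u v w n).
Proof.
intros Hw Hu. induction n as [|n IH]; intros H.
- unfold sinc_ratio; simpl. rewrite ln_1, Rplus_0_l. lra.
- rewrite S_INR in H. pose proof (pos_INR n) as Hn.
  rewrite ln_sinc_ratio_S; [|lra|lra|nra]. rewrite S_INR.
  specialize (IH ltac:(nra)).
  pose proof (ln_sinc_concave (w * (INR n + u)) (w * (INR n + v)) (w * (INR n + 1 + v))
     ltac:(nra) ltac:(nra) ltac:(nra) ltac:(nra)) as HC.
  replace (w * (INR n + v) - w * (INR n + u)) with (w * (v - u)) in HC by ring.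
  replace (w * (INR n + 1 + v) - w * (INR n + v)) with w in HC by ring.
  rewrite <- Rmult_assoc, (Rmult_comm _ w), Rmult_assoc, (Rmult_comm _ w) in HC.
  apply Rmult_le_reg_l in HC; lra.
Qed.

Lemma ln_sinc_ratio_upper (u v w : R) (n : nat) :
  0 < w -> 0 < u < v -> w * (INR n + v) < PI ->
  ln (sinc_ratio u v w (S n)) <=
  ln (sinc (w * v)) - ln (sinc (w * u)) +
    (v - u) * (ln (sinc (w * (INR n + u))) - ln (sinc (w * u))).
Proof.
intros Hw Hu. induction n as [|n IH]; intros H.
(* The first factor is kept exactly: the segment of length [w] to its left may leave (0, pi). *)
- rewrite ln_sinc_ratio_S by lra. unfold sinc_ratio; simpl. rewrite ln_1, !Rplus_0_l. lra.
- rewrite S_INR in H. pose proof (pos_INR n) as Hn.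
  rewrite ln_sinc_ratio_S; [|lra|lra|rewrite S_INR; lra]. rewrite S_INR.
  specialize (IH ltac:(nra)).
  pose proof (ln_sinc_concave (w * (INR n + u)) (w * (INR n + 1 + u)) (w * (INR n + 1 + v))
     ltac:(nra) ltac:(nra) ltac:(nra) ltac:(nra)) as HC.
  replace (w * (INR n + 1 + u) - w * (INR n + u)) with w in HC by ring.
  replace (w * (INR n + 1 + v) - w * (INR n + 1 + u)) with (w * (v - u)) in HC by ring.
  rewrite <- (Rmult_assoc _ w (v - u)), (Rmult_comm _ w), (Rmult_comm _ w), Rmult_assoc in HC.
  apply Rmult_le_reg_l in HC; lra.
Qed.

(** Positivity keeps the sequence away from 0, where division by zero gives [sinc] the value 0
    instead of its limit 1. *)
Lemma ln_sinc_lim_0 (x : nat -> R) : eventually (fun n => 0 < x n) ->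
  is_lim_seq x 0 -> is_lim_seq (fun n => ln (sinc (x n))) 0.
Proof.
intros Hx H. rewrite <- ln_1.
apply (is_lim_seq_continuous ln).
- apply derivable_continuous_pt. eexists. apply derivable_pt_lim_ln; lra.
- apply (is_lim_comp_seq sinc x 0 1).
  + apply is_lim_sinc_0.
  + revert Hx. apply filter_imp. intros n Hn E. injection E. lra.
  + exact H.
Qed.

Lemma ln_sinc_lim_PI2 (x : nat -> R) :
  is_lim_seq x (PI / 2) -> is_lim_seq (fun n => ln (sinc (x n))) (ln (2 / PI)).
Proof.
intros H. pose proof PI_RGT_0.
replace (2 / PI) with (sinc (PI / 2)).
2:{ unfold sinc. rewrite sin_PI2. field. lra. }
apply (is_lim_seq_continuous (fun t => ln (sinc t))); [|exact H].
apply derivable_continuous_pt. eexists. apply ln_sinc_derive. lra.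
Qed.

Lemma is_lim_seq_affine_index (w : nat -> R) (l c : R) :
  is_lim_seq w 0 -> is_lim_seq (fun n => w n * INR n) l ->
  is_lim_seq (fun n => w n * (INR n + c)) l.
Proof.
intros H0 H. apply (is_lim_seq_ext (fun n => w n * INR n + w n * c)).
{ intros; ring. }
replace (Finite l) with (Finite (l + 0 * c)) by (f_equal; ring).
apply is_lim_seq_plus'; [exact H|].
apply is_lim_seq_mult'; [exact H0 | apply is_lim_seq_const].
Qed.

Lemma sinc_ratio_lim_lt (u v : R) (w : nat -> R) : 0 < u < v ->
  (forall n, 0 < w n) -> is_lim_seq w 0 -> is_lim_seq (fun n => w n * INR n) (PI / 2) ->
  is_lim_seq (fun n => sinc_ratio u v (w n) n) (Rpower (2 / PI) (v - u)).
Proof.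
intros Hu Hw H0 H. pose proof PI_RGT_0 as HPI.
assert (Hev : eventually (fun n => w n * (INR n + v) < PI)).
{ pose proof (is_lim_seq_affine_index w _ v H0 H) as HL.
  apply is_lim_seq_spec in HL. destruct (HL (mkposreal (PI / 2) ltac:(lra))) as [n0 Hn0].
  exists n0. intros n Hn. specialize (Hn0 n Hn). simpl in Hn0.
  apply Rabs_def2 in Hn0. lra. }
assert (Hc : forall c, 0 < c -> is_lim_seq (fun n => ln (sinc (w n * c))) 0).
{ intros c Hc. apply ln_sinc_lim_0.
  - exists 0%nat. intros n _. now apply Rmult_lt_0_compat.
  - replace (Finite 0) with (Finite (0 * c)) by (f_equal; ring).
    apply is_lim_seq_mult'; [exact H0 | apply is_lim_seq_const]. }
assert (Hl : is_lim_seq (fun n => ln (sinc_ratio u v (w n) n)) ((v - u) * ln (2 / PI))).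
{ apply (is_lim_seq_le_le_loc
    (fun n => (v - u) * (ln (sinc (w n * (INR n + v))) - ln (sinc (w n * v)))) _
    (fun n => ln (sinc (w n * v)) - ln (sinc (w n * u)) +
       (v - u) * (ln (sinc (w n * (INR n + (u - 1)))) - ln (sinc (w n * u))))).
  - destruct Hev as [n0 Hn0]. exists (S n0). intros n Hn. split.
    + apply ln_sinc_ratio_lower; [apply Hw | exact Hu | apply Hn0; lia].
    + destruct n as [|m]; [lia|].
      replace (INR (S m) + (u - 1)) with (INR m + u) by (rewrite S_INR; ring).
      apply ln_sinc_ratio_upper; [apply Hw | exact Hu |].
      specialize (Hn0 (S m) ltac:(lia)). rewrite S_INR in Hn0.
      pose proof (Hw (S m)). nra.
  - replace (Finite ((v - u) * ln (2 / PI))) with (Finite ((v - u) * (ln (2 / PI) - 0)))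
      by (f_equal; ring).
    apply is_lim_seq_mult'; [apply is_lim_seq_const|].
    apply is_lim_seq_minus'; [|apply Hc; lra].
    apply ln_sinc_lim_PI2. now apply is_lim_seq_affine_index.
  - replace (Finite ((v - u) * ln (2 / PI)))
      with (Finite (0 - 0 + (v - u) * (ln (2 / PI) - 0))) by (f_equal; ring).
    apply is_lim_seq_plus'; [apply is_lim_seq_minus'; apply Hc; lra|].
    apply is_lim_seq_mult'; [apply is_lim_seq_const|].
    apply is_lim_seq_minus'; [|apply Hc; lra].
    apply ln_sinc_lim_PI2. now apply is_lim_seq_affine_index. }
apply (is_lim_seq_ext_loc (fun n => exp (ln (sinc_ratio u v (w n) n)))).
- revert Hev. apply filter_imp. intros n Hn. apply exp_ln.
  now apply sinc_ratio_pos.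
- apply (is_lim_seq_continuous exp); [|exact Hl].
  apply derivable_continuous_pt. apply derivable_pt_exp.
Qed.

Lemma sinc_ratio_inv (u v w : R) (n : nat) : sinc_ratio v u w n = / sinc_ratio u v w n.
Proof.
induction n as [|n IH].
- unfold sinc_ratio; simpl. now rewrite Rinv_1.
- now rewrite !sinc_ratio_S, Rinv_mult, IH, Rinv_div.
Qed.

(** Both orders occur, since a lies strictly between the two values 1/2 and 1 of c; the case v < u
    follows by inverting the ratio. *)
Lemma sinc_ratio_lim (u v : R) (w : nat -> R) : 0 < u -> 0 < v -> u <> v ->
  (forall n, 0 < w n) -> is_lim_seq w 0 -> is_lim_seq (fun n => w n * INR n) (PI / 2) ->
  is_lim_seq (fun n => sinc_ratio u v (w n) n) (Rpower (2 / PI) (v - u)).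
Proof.
intros Hu Hv Huv Hw H0 H. destruct (Rlt_or_le u v) as [Hlt|Hle].
- now apply sinc_ratio_lim_lt.
- apply (is_lim_seq_ext (fun n => / sinc_ratio v u (w n) n)).
  { intros n. symmetry. apply sinc_ratio_inv. }
  replace (v - u) with (- (u - v)) by ring. rewrite Rpower_Ropp.
  apply (is_lim_seq_inv _ (Finite _)).
  + apply sinc_ratio_lim_lt; trivial. lra.
  + intros E. injection E. apply Rgt_not_eq, exp_pos.
Qed.

(** * Finite products and the factorization of the cotangent product *)

Lemma prod_1_to_ext (f g : nat -> R) (n : nat) :
  (forall j, (1 <= j <= n)%nat -> f j = g j) -> prod_1_to f n = prod_1_to g n.
Proof.
induction n as [|n IH]; intros H; [reflexivity|].
cbn [prod_1_to]. rewrite H by lia. rewrite IH; [reflexivity|]. intros; apply H; lia.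
Qed.

Lemma prod_1_to_mult (f g : nat -> R) (n : nat) :
  prod_1_to (fun j => f j * g j) n = prod_1_to f n * prod_1_to g n.
Proof.
induction n as [|n IH]; cbn [prod_1_to]; [ring|]. rewrite IH. ring.
Qed.

Lemma prod_1_to_inv (f : nat -> R) (n : nat) :
  prod_1_to (fun j => / f j) n = / prod_1_to f n.
Proof.
induction n as [|n IH]; cbn [prod_1_to]; [now rewrite Rinv_1|]. now rewrite IH, Rinv_mult.
Qed.

Lemma prod_1_to_sqr (f : nat -> R) (n : nat) :
  prod_1_to (fun j => f j ^ 2) n = prod_1_to f n ^ 2.
Proof.
induction n as [|n IH]; cbn [prod_1_to]; [ring|]. rewrite IH. ring.
Qed.

Lemma prod_1_to_first (f : nat -> R) (n : nat) :
  prod_1_to f (S n) = f 1%nat * prod_1_to (fun j => f (S j)) n.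
Proof.
induction n as [|n IH]; [cbn; ring|].
change (prod_1_to f (S (S n))) with (prod_1_to f (S n) * f (S (S n))).
rewrite IH. cbn [prod_1_to]. ring.
Qed.

Lemma prod_1_to_rev (f : nat -> R) (n : nat) :
  prod_1_to (fun j => f (S n - j)%nat) n = prod_1_to f n.
Proof.
induction n as [|n IH]; [reflexivity|].
rewrite prod_1_to_first. cbn [prod_1_to]. rewrite <- IH.
rewrite Rmult_comm. f_equal.
Qed.

Lemma cot_psi_prod (T N n : nat) (c : R) : (1 <= T)%nat -> 0 < c -> INR N = 2 * INR n + 2 * c ->
  let a := (INR T + 2) / (2 * INR T) in
  0 < INR n + a + c - 1 ->
  prod_1_to (fun j => cot (psi N T j / 2) ^ 2) n =
  (poch c n / poch a n) ^ 2 * sinc_ratio a c (PI / (2 * (INR n + a + c - 1))) n ^ 2.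
Proof.
intros HT Hc HN a HM. set (w := PI / (2 * (INR n + a + c - 1))).
assert (HTR : 1 <= INR T) by (now apply (le_INR 1)).
assert (Ha : 0 < a) by (apply Rdiv_lt_0_compat; lra).
assert (Hw : 0 < w) by (apply Rdiv_lt_0_compat; [apply PI_RGT_0 | lra]).
assert (Hpsi : forall j, psi N T j / 2 = w * (INR j - 1 + a)).
{ intros j. unfold psi, w. rewrite HN.
  replace (2 + (2 * INR n + 2 * c - 1) * INR T) with (2 * INR T * (INR n + a + c - 1))
    by (unfold a; field; lra).
  replace (2 + INR T * (2 * INR j - 1)) with (2 * INR T * (INR j - 1 + a))
    by (unfold a; field; lra).
  field. lra. }
(* Since pi/2 = w (n + a + c - 1), the complement of the angle w (j-1+a) is w (n-j+c), which has the
   same shape with c for a and the index reversed. *)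
assert (Hcos : forall j, (1 <= j <= n)%nat ->
          cos (psi N T j / 2) = sin (w * (INR (S n - j) - 1 + c))).
{ intros j Hj. rewrite Hpsi, minus_INR by lia. rewrite S_INR, <- sin_shift. f_equal.
  unfold w. field. lra. }
rewrite prod_1_to_sqr, <- Rpow_mult_distr. f_equal.
unfold cot, Rdiv at 1.
rewrite (prod_1_to_mult (fun j => cos (psi N T j / 2)) (fun j => / sin (psi N T j / 2))).
rewrite (prod_1_to_ext _ _ n Hcos).
rewrite (prod_1_to_rev (fun j => sin (w * (INR j - 1 + c)))).
rewrite <- prod_1_to_mult.
unfold poch, sinc_ratio. rewrite (Rdiv_def (prod_1_to _ n)), <- prod_1_to_inv, <- !prod_1_to_mult.
apply prod_1_to_ext. intros j Hj. rewrite Hpsi. unfold sinc.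
assert (1 <= INR j) by (now apply (le_INR 1)).
(* If this sine vanishes, both sides are 0 by the convention [/ 0 = 0], so the angle does not have
   to be located. *)
destruct (Req_dec (sin (w * (INR j - 1 + a))) 0) as [E|E].
- unfold Rdiv. rewrite E, !Rinv_mult, !Rinv_0. ring.
- field. repeat split; lra.
Qed.

(** Three limits are multiplied: [kappa] from the linear factors, (2/pi)^(2(c-a)) from the squared
    sinc factors, and 2^(2(a-c)) from replacing n by N in the power. The powers of 2 cancel. *)
Lemma cot_psi_prod_lim (T : nat) (N : nat -> nat) (c kappa : R) : (1 <= T)%nat -> 0 < c ->
  (forall n, INR (N n) = 2 * INR n + 2 * c) ->
  let a := (INR T + 2) / (2 * INR T) in
  1 < a + c -> a <> c ->
  is_lim_seq (fun n => (poch c n / poch a n) ^ 2 * Rpower (INR n) (2 * (a - c))) kappa ->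
  is_lim_seq (fun n => prod_1_to (fun j => cot (psi (N n) T j / 2) ^ 2) n *
                 Rpower (INR (N n)) (2 * (a - c)))
    (kappa * Rpower PI (2 * (a - c))).
Proof.
intros HT Hc HN a Hac Hne Hk.
assert (HTR : 1 <= INR T) by (now apply (le_INR 1)).
assert (Ha : 0 < a) by (apply Rdiv_lt_0_compat; lra).
pose proof PI_RGT_0 as HPI.
pose (w := fun n => PI / (2 * (INR n + a + c - 1))).
(* [1 < a + c] makes the denominator positive already at [n = 0]. *)
assert (Hw : forall n, 0 < w n).
{ intros n. pose proof (pos_INR n). apply Rdiv_lt_0_compat; lra. }
assert (Hw0 : is_lim_seq w 0).
{ apply (is_lim_seq_ext (fun n => PI / 2 * / (INR n + (a + c - 1)))).
  { intros n. pose proof (pos_INR n). unfold w. field. lra. }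
  replace (Finite 0) with (Finite (PI / 2 * 0)) by (f_equal; ring).
  apply is_lim_seq_mult'; [apply is_lim_seq_const | apply is_lim_seq_inv_shift]. }
assert (Hw1 : is_lim_seq (fun n => w n * INR n) (PI / 2)).
{ apply (is_lim_seq_ext (fun n => PI / 2 * ((INR n + 0) / (INR n + (a + c - 1))))).
  { intros n. pose proof (pos_INR n). unfold w. field. lra. }
  replace (Finite (PI / 2)) with (Finite (PI / 2 * 1)) by (f_equal; ring).
  apply is_lim_seq_mult'; [apply is_lim_seq_const | apply is_lim_seq_shift_ratio]. }
pose proof (sinc_ratio_lim a c w Ha Hc Hne Hw Hw0 Hw1) as HS.
assert (HR : is_lim_seq (fun n => Rpower (2 * ((INR n + c) / (INR n + 0))) (2 * (a - c)))
               (Rpower 2 (2 * (a - c)))).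
{ apply is_lim_seq_Rpower; [lra|].
  replace (Finite 2) with (Finite (2 * 1)) by (f_equal; ring).
  apply is_lim_seq_mult'; [apply is_lim_seq_const | apply is_lim_seq_shift_ratio]. }
replace (kappa * Rpower PI (2 * (a - c)))
  with (kappa * (Rpower (2 / PI) (c - a) * Rpower (2 / PI) (c - a)) * Rpower 2 (2 * (a - c))).
2:{ rewrite Rmult_assoc. f_equal. unfold Rpower. rewrite ln_div by lra.
    rewrite <- !exp_plus. f_equal. ring. }
apply (is_lim_seq_ext_loc (fun n =>
  (poch c n / poch a n) ^ 2 * Rpower (INR n) (2 * (a - c)) *
  (sinc_ratio a c (w n) n * sinc_ratio a c (w n) n) *
  Rpower (2 * ((INR n + c) / (INR n + 0))) (2 * (a - c)))).
- exists 1%nat. intros n Hn. apply (le_INR 1) in Hn. simpl in Hn.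
  rewrite (cot_psi_prod T (N n) n c HT Hc (HN n)) by (fold a; lra).
  fold a. fold (w n). rewrite HN.
  assert (E : Rpower (2 * INR n + 2 * c) (2 * (a - c)) =
     Rpower (INR n) (2 * (a - c)) * Rpower (2 * ((INR n + c) / (INR n + 0))) (2 * (a - c))).
  { rewrite Rpower_mult_distr.
    - f_equal. field. lra.
    - lra.
    - apply Rmult_lt_0_compat; [lra | apply Rdiv_lt_0_compat; lra]. }
  rewrite E. ring.
- apply is_lim_seq_mult'; [apply is_lim_seq_mult'|]; trivial.
  now apply is_lim_seq_mult'.
Qed.

(** * The two parities and the final limit *)

Lemma is_lim_seq_even_odd (u : nat -> R) (l : R) :
  is_lim_seq (fun n => u (2 * n + 2)%nat) l -> is_lim_seq (fun n => u (2 * n + 1)%nat) l ->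
  is_lim_seq u l.
Proof.
intros He Ho. apply is_lim_seq_spec. intros eps.
apply is_lim_seq_spec in He. apply is_lim_seq_spec in Ho.
destruct (He eps) as [n1 H1]. destruct (Ho eps) as [n2 H2].
(* Even indices are written 2n + 2, for which [P] has exactly n factors, as it has at 2n + 1; an
   even 2k thus corresponds to k - 1, which explains the extra 2. *)
exists (2 * (n1 + n2) + 2)%nat. intros n Hn.
destruct (Nat.Even_or_Odd n) as [[k Hk]|[k Hk]].
- replace n with (2 * (k - 1) + 2)%nat by lia. apply H1. lia.
- replace n with (2 * k + 1)%nat by lia. apply H2. lia.
Qed.

Theorem theorem1 (T : nat) (hT : (3 <= T)%nat) :
  exists g : R,
    is_Gamma ((INR T + 2) / (2 * INR T)) g /\
    Un_cv (fun N : nat => P T N * Rpower (INR N) (2 / INR T))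
          (Rpower PI ((2 - INR T) / INR T) * g ^ 2).
Proof.
assert (HTR : 3 <= INR T) by (now apply (le_INR 3) in hT; simpl in hT; lra).
pose proof PI_RGT_0 as HPI.
set (a := (INR T + 2) / (2 * INR T)).
(* Here a = 1/2 + 1/T, so the exponents of the statement are 2/T = 2(a - 1/2) and (2-T)/T = 2(a -
   1). *)
assert (Ha : 1 / 2 < a < 1).
{ assert (a = 1 / 2 + / INR T) by (unfold a; field; lra).
  assert (/ INR T <= / 3) by (apply Rinv_le_contravar; lra).
  assert (0 < / INR T) by (apply Rinv_0_lt_compat; lra). lra. }
destruct (ex_gamma_lim a ltac:(lra)) as [g Hg].
exists g. split; [now apply is_gamma_lim_is_Gamma|].
apply is_lim_seq_Reals.
pose proof (gauss_limit a g ltac:(lra) Hg) as HG.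
assert (HG2 : is_lim_seq (fun n => (poch 1 n / poch a n) ^ 2 * Rpower (INR n) (2 * (a - 1))) (g * g)).
{ eapply is_lim_seq_ext; [|exact (is_lim_seq_mult' _ _ _ _ HG HG)].
  intros n. simpl. replace (2 * (a - 1)) with ((a - 1) + (a - 1)) by ring.
  rewrite Rpower_plus. ring. }
replace (2 / INR T) with (2 * (a - 1 / 2)) by (unfold a; field; lra).
replace ((2 - INR T) / INR T) with (2 * (a - 1)) by (unfold a; field; lra).
apply is_lim_seq_even_odd.
- assert (HN : forall n, INR (2 * n + 2) = 2 * INR n + 2 * 1).
  { intros n. rewrite plus_INR, mult_INR. simpl. ring. }
  pose proof (cot_psi_prod_lim T (fun n => 2 * n + 2)%nat 1 (g * g) ltac:(lia) Rlt_0_1 HN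
    ltac:(fold a; lra) ltac:(fold a; lra) HG2) as HL. fold a in HL.
  replace (Rpower PI (2 * (a - 1)) * g ^ 2) with (g * g * Rpower PI (2 * (a - 1)) * 1) by ring.
  (* The case c = 1 gives the power N^(2(a-1)), one short of N^(2/T). The missing factor N = 2(n+1)
     meets the prefactor 1 / (2(n+a)) of [P], and their product tends to 1. *)
  eapply is_lim_seq_ext; [|exact (is_lim_seq_mult' _ _ _ _ HL (is_lim_seq_shift_ratio 1 a))].
  intros n. unfold P.
  replace (Nat.even (2 * n + 2)) with true
    by (symmetry; apply Nat.even_spec; exists (n + 1)%nat; lia).
  replace ((2 * n + 2 - 2) / 2)%nat with n
    by (replace (2 * n + 2 - 2)%nat with (n * 2)%nat by lia; now rewrite Nat.div_mul).
  pose proof (pos_INR n).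
  assert (E : Rpower (INR (2 * n + 2)) (2 * (a - 1 / 2)) =
              Rpower (INR (2 * n + 2)) (2 * (a - 1)) * (2 * INR n + 2)).
  { replace (2 * (a - 1 / 2)) with (2 * (a - 1) + 1) by field.
    rewrite Rpower_plus, Rpower_1, HN by (rewrite HN; lra). ring. }
  rewrite E, HN.
  replace (INR T / (2 + (2 * INR n + 2 * 1 - 1) * INR T)) with (/ (2 * (INR n + a))).
  { field. lra. }
  replace (2 + (2 * INR n + 2 * 1 - 1) * INR T) with (INR T * (2 * (INR n + a)))
    by (unfold a; field; lra).
  field. lra.
- assert (HN : forall n, INR (2 * n + 1) = 2 * INR n + 2 * (1 / 2)).
  { intros n. rewrite plus_INR, mult_INR. simpl. field. }
  (* For c = 1/2 insert [poch 1 n]: Wallis contributes 1/pi and Gauss [g * g]. The factor 1/pi then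
     lowers the exponent of pi from 2(a - 1/2) to 2(a - 1), the same as in the even case. *)
  assert (HG3 : is_lim_seq (fun n => (poch (1 / 2) n / poch a n) ^ 2 *
                  Rpower (INR n) (2 * (a - 1 / 2))) (/ PI * (g * g))).
  { eapply is_lim_seq_ext_loc; [|exact (is_lim_seq_mult' _ _ _ _ wallis_limit HG2)].
    exists 1%nat. intros n Hn. apply (le_INR 1) in Hn. simpl (INR 1) in Hn.
    replace (2 * (a - 1 / 2)) with (2 * (a - 1) + 1) by field.
    rewrite Rpower_plus, Rpower_1 by lra.
    pose proof (poch_pos 1 n Rlt_0_1). pose proof (poch_pos a n ltac:(lra)).
    field. lra. }
  pose proof (cot_psi_prod_lim T (fun n => 2 * n + 1)%nat (1 / 2) _ ltac:(lia) ltac:(lra) HN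
    ltac:(fold a; lra) ltac:(fold a; lra) HG3) as HL. fold a in HL.
  replace (Rpower PI (2 * (a - 1)) * g ^ 2)
    with (/ PI * (g * g) * Rpower PI (2 * (a - 1 / 2))).
  2:{ replace (2 * (a - 1 / 2)) with (2 * (a - 1) + 1) by field.
      rewrite Rpower_plus, Rpower_1 by lra. field. lra. }
  eapply is_lim_seq_ext; [|exact HL].
  intros n. unfold P.
  replace (Nat.even (2 * n + 1)) with false
    by (rewrite Nat.even_add, Nat.even_mul; reflexivity).
  replace ((2 * n + 1 - 1) / 2)%nat with n
    by (replace (2 * n + 1 - 1)%nat with (n * 2)%nat by lia; now rewrite Nat.div_mul).
  reflexivity.
Qed.
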